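(* Let $X\in\mathcal{X}\subseteq\mathbb{R}$ and $Y\in\mathcal{Y}\subseteq\mathbb{R}$ be random variables such that the conditional pdf of $Y$ given $X$ has the univariate exponential family form $$f_{Y|X}(y|x) = h(y)\, e^{x T(y) - \phi(x)}, \qquad y\in\mathcal{Y},\ x\in\mathcal{X},$$ and assume the regularity conditions (R) listed in the context. For $\ell\in\mathbb{N}$ let $D_y^{(\ell)}$ be the $\ell$-fold composition of the operator $\frac{1}{T'(y)}\frac{\mathrm{d}}{\mathrm{d}y}$, with $D_y^{(0)}=1$ (the identity). Then, for every $\ell\in\mathbb{N}$, every $a\in\mathcal{Y}$, and every $y\in\mathcal{Y}$ with $T'(y)\ne0$ (and such that the interval between $a$ and $y$ is contained in $\mathcal{Y}$, so that the integrals below are defined), $$\mathbb{E}[X^{\ell+1}|Y=y] = e^{-\int_a^y T'(u)\,\mathbb{E}[X|Y=u]\,\mathrm{d}u}\; D_y^{(\ell+1)}\, e^{\int_a^y T'(u)\,\mathbb{E}[X|Y=u]\,\mathrm{d}u}.$$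
   Context: Exponential family: $T:\mathcal{Y}\to\mathbb{R}$ is the sufficient statistic, $\phi:\mathcal{X}\to\mathbb{R}$ the log-partition function, $h:\mathcal{Y}\to[0,\infty)$ the base measure. Standing assumptions: $\mathcal{Y}$ is open, $h$ is absolutely continuous with respect to Lebesgue measure, and $T$ is analytic, with $T'$ having only isolated zeros (the operator $D_y^{(\ell)}$ is not defined at those zeros). Operator: $D_y^{(\ell)} = \underbrace{\frac{1}{T'(y)}\frac{\mathrm{d}}{\mathrm{d}y}\,\frac{1}{T'(y)}\frac{\mathrm{d}}{\mathrm{d}y}\cdots\frac{1}{T'(y)}\frac{\mathrm{d}}{\mathrm{d}y}}_{\ell\text{ times}}$. Regularity conditions (R): for every integer $\ell\ge1$ and $U=X^\ell$: $\mathbb{E}[|U| \mid Y=y]<\infty$, $\mathbb{E}[|U|\,|X| \mid Y=y]<\infty$ and $\mathbb{E}[|X| \mid Y=y]<\infty$ for all $y\in\mathcal{Y}$; and $y\mapsto x^\ell\,\iota_{P_{X,Y}}(x;y)$ and $y\mapsto f_{Y|X}(y|x)$ are absolutely continuous for every $x$. Here $\iota_{P_{X,Y}}(x;y) = \log\frac{f_{Y|X}(y|x)}{f_Y(y)}$ is the information density, with $f_Y$ the marginal pdf of $Y$. *)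

(* Defs.v *)
From HB Require Import structures.
From mathcomp Require Import all_boot all_order all_algebra.
From mathcomp Require Import all_classical all_reals all_analysis.
Set Implicit Arguments.
Unset Strict Implicit.
Unset Printing Implicit Defensive.
Import Order.TTheory GRing.Theory Num.Theory.
Import numFieldNormedType.Exports.

Local Open Scope classical_set_scope.
Local Open Scope ring_scope.

Definition real_analytic_at {R : realType} (f : R -> R) (x : R) : Prop :=
  exists c : R^nat,
    \forall y \near x, pseries c (y - x) n @[n --> \oo] --> f y.

Definition abs_continuous_itv {R : realType} (a b : R) (f : R -> R) : Prop :=
  forall e : R, 0 < e -> exists2 r : R, 0 < r &
    forall (n : nat) (u v : 'I_n -> R),
      (forall i, a <= u i /\ u i <= v i /\ v i <= b) ->
      trivIset [set: 'I_n] (fun i => `]u i, v i[%classic) ->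
      \sum_(i < n) (v i - u i) < r ->
      \sum_(i < n) `|f (v i) - f (u i)| < e.

(* On an open set, absolute continuity is understood on every compact
   subinterval: the global epsilon-delta condition fails on an unbounded set
   already for quadratic information densities, as in the Gaussian case. *)
Definition abs_continuous_on {R : realType} (D : set R) (f : R -> R) : Prop :=
  forall a b : R, a <= b -> `[a, b]%classic `<=` D -> abs_continuous_itv a b f.

Definition oriented_integral {R : realType} (f : R -> R) (a b : R) : R :=
  if a <= b then \int[lebesgue_measure]_(u in `[a, b]) f u
  else - \int[lebesgue_measure]_(u in `[b, a]) f u.

Definition segment_between {R : realType} (a b : R) : set R :=
  `[Order.min a b, Order.max a b]%classic.

(* Meaningful only where T' does not vanish. *)
Definition Dop {R : realType} (T : R -> R) (l : nat) (g : R -> R) : R -> R :=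
  iter l (fun (k : R -> R) (y : R) => (derive1 T y)^-1 * derive1 k y) g.

Section conditional.
Context {R : realType} {d : measure_display} {Omega : measurableType d}.
Variables (P : probability Omega R) (X Y : {RV P >-> R}).
Variables (SX SY : set R).
(* [f x y] stands for f_{Y|X}(y|x); X takes values in SX and Y in SY. *)
Variable f : R -> R -> R.
Local Open Scope ereal_scope.

Definition is_conditional_pdf : Prop :=
  (forall x, SX x ->
     [/\ measurable_fun SY (f x),
         (forall y, SY y -> (0 <= f x y)%R) &
         \int[lebesgue_measure]_(y in SY) (f x y)%:E = 1]) /\
  (forall A B : set R, measurable A -> measurable B ->
     P (X @^-1` A `&` Y @^-1` B) =
     \int[P]_(w in X @^-1` A)
        \int[lebesgue_measure]_(y in SY `&` B) (f (X w) y)%:E).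

(* f_Y(y), the integral of f_{Y|X}(y|x) against the law of X. *)
Definition marginal_pdf (y : R) : \bar R := \int[P]_w (f (X w) y)%:E.

(* E[g(X) | Y = y] is required at every point y, not only up to null sets;
   it is the integral of g against the posterior law of X given Y = y, whose
   density with respect to the law of X is f_{Y|X}(y|x) / f_Y(y). *)
Definition cond_expectation (g : R -> R) (y : R) : \bar R :=
  (\int[P]_w (g (X w) * f (X w) y)%:E) / marginal_pdf y.

(* Finite exactly when f x y > 0 and 0 < f_Y(y) < +oo: in \bar R,
   0 / 0 = 0, 1 / +oo = 0, and lne 0 = -oo. *)
Definition info_density (x y : R) : \bar R :=
  lne ((f x y)%:E / marginal_pdf y).

(* The information density has to be real-valued for its absolute continuity
   to make sense; this also makes every E[. | Y = y], y in SY, well defined. *)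
Definition regularity : Prop :=
  [/\ (forall x y, SX x -> SY y -> info_density x y \is a fin_num),
      (forall l : nat, (1 <= l)%N -> forall y, SY y ->
         [/\ cond_expectation (fun x => `|x ^+ l|%R) y < +oo,
             cond_expectation (fun x => (`|x ^+ l| * `|x|)%R) y < +oo &
             cond_expectation (fun x => `|x|%R) y < +oo]),
      (forall l : nat, (1 <= l)%N -> forall x, SX x ->
         abs_continuous_on SY (fun y => (x ^+ l * fine (info_density x y))%R)) &
      (forall x, SX x -> abs_continuous_on SY (f x))].

(* T'(u) E[X | Y = u] *)
Definition weighted_mean (T : R -> R) (u : R) : R :=
  (derive1 T u * fine (cond_expectation id u))%R.

End conditional.

(* Main.v *)
Require Import Defs.
From HB Require Import structures.
From mathcomp Require Import all_boot all_order all_algebra.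
From mathcomp Require Import all_classical all_reals all_analysis.
From mathcomp Require Import measurable_realfun ring lra.
Set Implicit Arguments.
Unset Strict Implicit.
Unset Printing Implicit Defensive.
Import Order.TTheory GRing.Theory Num.Theory.
Import numFieldNormedType.Exports.

Local Open Scope classical_set_scope.
Local Open Scope ring_scope.

(** Put [F_k(u) = E[X^k exp (X T(u) - phi(X))]].  The factor [h(y)] cancels in
    the posterior, so [E[X^k | Y = y] = F_k(y) / F_0(y)], and differentiating
    under the integral sign gives [F_k' = T' F_(k+1)] on the open set [SY]: on a
    compact interval around a point, [T] attains its extrema at points [p], [q] of
    [SY], and [exp (x T(u)) <= exp (x T(p)) + exp (x T(q))] is a dominating bound
    that is integrable by the moment conditions, even where [T'] vanishes.
    Hence [T' E[X | Y = .]] is the continuous derivative of [ln F_0], the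
    exponential of its integral from [a] is [F_0 / F_0(a)], and applying [D_y]
    repeatedly turns this into [F_k / F_0(a)]. *)

(** * Power series: radius of convergence and termwise differentiation *)

Section PowerSeries.
Context {R : realType}.
Implicit Types (c : R^nat) (x z r : R) (T : R -> R).

(** Each of the [n.+1] summands in the factorization of [r ^+ n.+1 - z ^+ n.+1] by [r - z] is at
    least [z ^+ n]. This absorbs the factor [n.+1] of a derived series into a slightly larger
    radius. *)
Lemma natrS_exp_le n z r : 0 <= z -> z <= r ->
  n.+1%:R * z ^+ n * (r - z) <= r ^+ n.+1.
Proof.
move=> z0 zr; elim: n => [|n IH]; first by rewrite expr0 expr1; lra.
have -> : n.+2%:R * z ^+ n.+1 * (r - z) =
    z * (n.+1%:R * z ^+ n * (r - z)) + z ^+ n.+1 * (r - z) :> R.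
  by rewrite -[n.+2]addn1 natrD exprS; ring.
have -> : r ^+ n.+2 = z * r ^+ n.+1 + r ^+ n.+1 * (r - z) :> R.
  by rewrite [in LHS]exprS; ring.
apply: lerD; first exact: ler_wpM2l.
by apply: ler_wpM2r; rewrite ?subr_ge0// lerXn2r// nnegrE (le_trans z0).
Qed.

(** Absolute convergence at [r], strictly between [y] and |x|, dominates the derived series at [y]
    up to a factor [(r - y)^-1]. *)
Lemma is_cvg_pseries_diffs c x z :
  cvgn (pseries c x) -> `|z| < `|x| -> cvgn (pseries (pseries_diffs c) z).
Proof.
move=> cx zx; pose y := (`|z| + `|x|) / 2; pose r := (y + `|x|) / 2.
have zy : `|z| < y by rewrite /y; lra.
have yr : y < r by rewrite /r /y; lra.
have rx : r < `|x| by rewrite /r /y; lra.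
have y0 : 0 < y by rewrite (le_lt_trans _ zy).
have cy : cvgn (pseries (pseries_diffs c) y); last first.
  by apply: is_cvg_pseries_inside cy _; rewrite (gtr0_norm y0).
have cr : cvgn (pseries (fun i => `|c i|) r).
  by apply: is_cvg_pseries_inside_norm cx _; rewrite gtr0_norm// (lt_trans y0).
apply: normed_cvg.
apply: (@series_le_cvg _ _ (fun n => (r - y)^-1 * (`|c n.+1| * r ^+ n.+1))).
- by move=> n /=; exact: normr_ge0.
- move=> n; rewrite mulr_ge0// ?invr_ge0 ?subr_ge0 ?(ltW yr)//.
  by rewrite mulr_ge0// exprn_ge0// ltW// (lt_trans y0).
- move=> n; rewrite /= /pseries_diffs normrM normrM normrX (gtr0_norm y0).
  rewrite [`|n.+1%:R|]ger0_norm// ler_pdivlMl ?subr_gt0//.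
  have := natrS_exp_le n (ltW y0) (ltW yr) => /(ler_wpM2l (normr_ge0 (c n.+1))).
  by apply: le_trans; rewrite le_eqVlt; apply/orP; left; apply/eqP; ring.
- apply: is_cvg_seriesZ.
  suff -> : series (fun n => `|c n.+1| * r ^+ n.+1) =
      (fun n => pseries (fun i => `|c i|) r n.+1 - `|c 0%N|).
    have /cvg_ex[s crs] := cr; apply/cvg_ex; exists (s - `|c 0%N|).
    by apply: cvgB; [rewrite cvg_shiftS|exact: cvg_cst].
  apply/funext => n; rewrite /pseries /series /= big_nat_recl//= expr0 mulr1.
  by rewrite addrAC subrr add0r.
Qed.

(** Differentiating the sum uses convergence of the series and of its first two derived series at a
    point beyond |z|. Each derivation costs some radius, hence the chain |z| < [y] < [r] < |x|. *)
Lemma is_derive_pseries c x z : cvgn (pseries c x) -> `|z| < `|x| ->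
  is_derive z 1 (fun z => limn (pseries c z)) (limn (pseries (pseries_diffs c) z)).
Proof.
move=> cx zx; pose y := (`|z| + `|x|) / 2; pose r := (y + `|x|) / 2.
have zy : `|z| < y by rewrite /y; lra.
have yr : y < r by rewrite /r /y; lra.
have rx : r < `|x| by rewrite /r /y; lra.
have y0 : 0 < y by rewrite (le_lt_trans _ zy).
have r0 : 0 < r by rewrite (lt_trans y0).
have cr := is_cvg_pseries_diffs cx (z := r).
rewrite (gtr0_norm r0) in cr.
apply: (@pseries_snd_diffs _ c y).
- by apply: is_cvg_pseries_inside cx _; rewrite gtr0_norm// (lt_trans yr).
- by apply: is_cvg_pseries_diffs cx _; rewrite gtr0_norm// (lt_trans yr).
- by apply: is_cvg_pseries_diffs (cr rx) _; rewrite !gtr0_norm.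
- by rewrite (gtr0_norm y0).
Qed.

(** Near [x] the derivative is the sum of the derived series, itself differentiable at 0; this gives
    the continuity of [derive1 T]. *)
Lemma real_analytic_derivable T x : real_analytic_at T x ->
  derivable T x 1 /\ {for x, continuous (derive1 T)}.
Proof.
move=> [c /nbhs_ballP[e /= e0 cT]].
have Tball y : `|x - y| < e -> pseries c (y - x) n @[n --> \oo] --> T y.
  by move=> yx; apply: cT.
(* With half the radius, [x + K] lies in the ball, and so does any point closer than [K] to a point
   closer than [K] to [x]. *)
pose K := e / 2.
have K0 : 0 < K by rewrite /K; lra.
have cK : cvgn (pseries c K).
  have := Tball (x + K); rewrite opprD addNKr normrN gtr0_norm//.
  rewrite [x + K - x]addrC addKr => cvK.
  by apply/cvg_ex; exists (T (x + K)); apply: cvK; rewrite /K; lra.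
have near_derive y : `|y - x| < K ->
    is_derive y 1 T (limn (pseries (pseries_diffs c) (y - x))).
  move=> yK.
  have D : is_derive y 1 (fun y => limn (pseries c (y - x)))
      (limn (pseries (pseries_diffs c) (y - x))).
    have sub_derive : is_derive y 1 (fun y : R => y - x) 1.
      by rewrite -[X in is_derive _ _ _ X]subr0; apply: is_deriveB.
    have := @is_derive1_comp _ (fun z => limn (pseries c z)) _ _ _ _
      (is_derive_pseries cK _) sub_derive.
    by rewrite mulr1; apply; rewrite (gtr0_norm K0).
  apply: near_eq_is_derive D.
  near=> u; apply/cvg_lim => //; apply: Tball.
  have -> : x - u = (x - y) + (y - u) by ring.
  apply: (le_lt_trans (ler_normD _ _)); rewrite (distrC x y).
  have : `|y - u| < K by near: u; exact: cvgr_dist_lt.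
  by rewrite /K; move: yK; rewrite /K; lra.
have derK : \forall y \near x, derive1 T y = limn (pseries (pseries_diffs c) (y - x)).
  near=> y; rewrite derive1E; apply: derive_val; apply: near_derive.
  by rewrite distrC; near: y; exact: cvgr_dist_lt.
have Tx : is_derive x 1 T (limn (pseries (pseries_diffs c) (x - x))).
  by apply: near_derive; rewrite subrr normr0.
split; first exact: ex_derive.
suff : {for x, continuous (fun y => limn (pseries (pseries_diffs c) (y - x)))}.
  rewrite /prop_for /continuous_at -(nbhs_singleton derK) => H.
  by apply: cvg_trans H; apply: near_eq_cvg; near=> y; apply/esym; near: y.
apply: (@continuous_comp _ _ _ (fun y => y - x)
   (fun z => limn (pseries (pseries_diffs c) z))).
  by apply: cvgB; [exact: cvg_id|exact: cvg_cst].
rewrite subrr.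
have cK2 : cvgn (pseries (pseries_diffs c) (K / 2)).
  by apply: is_cvg_pseries_diffs cK _; rewrite !gtr0_norm// ?divr_gt0//; lra.
have D := is_derive_pseries cK2 (z := 0).
apply: differentiable_continuous; apply/derivable1_diffP.
by case: D => //; rewrite normr0 gtr0_norm divr_gt0.
Unshelve. all: by end_near. Qed.

End PowerSeries.

(** * Differentiation of exponentially tilted moments under the integral *)

Section TiltedMoments.
Context {R : realType} {d : measure_display} {Omega : measurableType d}.
Variables (mu : {measure set Omega -> \bar R}) (X g : Omega -> R).
Variables (T : R -> R) (D : set R).
Hypothesis D_open : open D.
Hypothesis g_ge0 : forall w, 0 <= g w.
Hypothesis T_derivable : forall u, D u -> derivable T u 1.
Hypothesis T_C1 : forall u, D u -> {for u, continuous (derive1 T)}.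

(** The weight [g] is abstract; taking it to be [expR (- phi (X w))] gives the F_k of the
    overview. *)
Definition tilted_moment (k : nat) (u : R) : R :=
  \int[mu]_w (X w ^+ k * expR (X w * T u) * g w).

Hypothesis tilted_integrable : forall k u, D u ->
  mu.-integrable setT (EFin \o (fun w => X w ^+ k * expR (X w * T u) * g w)).

(** The map s -> exp (x s) is monotone, in a direction set by the sign of [x]; the sum of both
    endpoint values covers both cases. *)
Lemma expR_between (x s p q : R) : p <= s -> s <= q ->
  expR (x * s) <= expR (x * p) + expR (x * q).
Proof.
move=> ps sq; have [x0|x0] := leP 0 x.
  by rewrite (le_trans (y := expR (x * q)))// ?ler_expR ?ler_wpM2l// lerDr expR_ge0.
rewrite (le_trans (y := expR (x * p)))// ?lerDl ?expR_ge0//.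
by rewrite ler_expR ler_wnM2l// ltW.
Qed.

Lemma is_derive_tilted w k u : derivable T u 1 ->
  is_derive u 1 (fun u => X w ^+ k * expR (X w * T u) * g w)
    (derive1 T u * (X w ^+ k.+1 * expR (X w * T u) * g w)).
Proof.
move=> dT; have DT : is_derive u 1 T (derive1 T u).
  by rewrite derive1E; exact: DeriveDef.
have DX : is_derive u 1 (fun u => X w * T u) (X w * derive1 T u).
  exact: is_deriveZ.
have DE : is_derive u 1 (fun u => expR (X w * T u))
    (expR (X w * T u) * (X w * derive1 T u)).
  exact: (@is_derive1_comp _ expR (fun u => X w * T u)).
rewrite (_ : (fun u => _) =
    (X w ^+ k * g w) *: (fun u => expR (X w * T u))); last first.
  by apply/funext => v /=; rewrite mulrAC.
rewrite (_ : derive1 T u * _ =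
    (X w ^+ k * g w) *: (expR (X w * T u) * (X w * derive1 T u))).
  exact: is_deriveZ.
by rewrite exprS /GRing.scale/=; ring.
Qed.

Lemma is_derive_tilted_moment k a : D a ->
  is_derive a 1 (tilted_moment k) (derive1 T a * tilted_moment k.+1 a).
Proof.
move=> Da.
have [e /= e0 eD] : exists2 e : R, 0 < e &
    forall u, `|a - u| <= e -> D u /\ `|derive1 T u| <= `|derive1 T a| + 1.
  have : \forall u \near a, D u /\ `|derive1 T u| <= `|derive1 T a| + 1.
    near=> u; split; first by near: u; exact: open_nbhs_nbhs.
    have : `|derive1 T a - derive1 T u| < 1.
      by near: u; apply: cvgr_dist_lt => //; exact: T_C1.
    have := ler_normD (derive1 T a) (derive1 T u - derive1 T a).
    by rewrite addrC subrK distrC; lra.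
  move=> /nbhs_ballP[e /= e0 eP]; exists (e / 2); first by rewrite divr_gt0.
  by move=> u ue; apply: eP; rewrite /ball/=; lra.
have itvP u : u \in `[a - e, a + e] -> `|a - u| <= e.
  by rewrite in_itv/= ler_norml => /andP[? ?]; apply/andP; split; lra.
have Tcont : {within `[a - e, a + e], continuous T}.
  by apply: derivable_within_continuous => u /itvP/eD[/T_derivable].
have aee : a - e <= a + e by lra.
(* Extremal points of [T] are used rather than values [T a] plus or minus a margin: integrability is
   known only at values that [T] takes on [D], and [a] may be a local extremum. *)
have [p /itvP/eD[Dp _] Tp] := EVT_min aee Tcont.
have [q /itvP/eD[Dq _] Tq] := EVT_max aee Tcont.
pose f u w := X w ^+ k * expR (X w * T u) * g w.
pose C := `|derive1 T a| + 1.
pose G w := C * (`|X w ^+ k.+1 * expR (X w * T p) * g w| +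
                 `|X w ^+ k.+1 * expR (X w * T q) * g w|).
have Ioc u : `]a - e, a + e[%classic u -> u \in `[a - e, a + e].
  by rewrite /= !in_itv/= => /andP[/ltW-> /ltW->].
have Ia : `]a - e, a + e[%classic a.
  by rewrite /= in_itv/=; apply/andP; split; lra.
have intf u : `]a - e, a + e[%classic u -> mu.-integrable setT (EFin \o f u).
  by move=> /Ioc/itvP/eD[Du _]; exact: tilted_integrable.
have derf u w : `]a - e, a + e[%classic u -> [set: Omega] w -> derivable (f ^~ w) u 1.
  move=> /Ioc/itvP/eD[Du _] _.
  by have [] := is_derive_tilted w k (T_derivable Du).
have d1f u w : `]a - e, a + e[%classic u ->
    partial1of2 f u w = derive1 T u * (X w ^+ k.+1 * expR (X w * T u) * g w).
  move=> /Ioc/itvP/eD[Du _]; rewrite partial1of2E.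
  by have [] := is_derive_tilted w k (T_derivable Du).
have G0 w : 0 <= G w by rewrite mulr_ge0 ?addr_ge0.
have intG : mu.-integrable setT (EFin \o G).
  rewrite (_ : EFin \o G = fun w => (C%:E *
      (`|X w ^+ k.+1 * expR (X w * T p) * g w| +
       `|X w ^+ k.+1 * expR (X w * T q) * g w|)%:E)%E)//.
  apply: integrableZl => //.
  rewrite (_ : (fun w => _) =
      (EFin \o (fun w => `|X w ^+ k.+1 * expR (X w * T p) * g w|)) \+
      (EFin \o (fun w => `|X w ^+ k.+1 * expR (X w * T q) * g w|)))//.
  by apply: integrableD => //; apply: integrable_norm; exact: tilted_integrable.
have G_ub u w : `]a - e, a + e[%classic u -> [set: Omega] w ->
    `|partial1of2 f u w| <= G w.
  move=> Iu _; rewrite d1f// normrM; have /eD[_ Cu] := itvP _ (Ioc _ Iu).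
  apply: ler_pM => //.
  rewrite !normrM !(ger0_norm (expR_ge0 _)) !(ger0_norm (g_ge0 _)) -mulrDl -mulrDr.
  apply: ler_wpM2r => //; apply: ler_wpM2l => //.
  by apply: expR_between; [exact/Tp/Ioc|exact/Tq/Ioc].
have dF := derivable_under_integral measurableT Ia intf derf G0 intG G_ub.
have := differentiation_under_integral measurableT Ia intf derf G0 intG G_ub.
rewrite derive1E => eF; apply: DeriveDef => //; rewrite eF /tilted_moment.
rewrite -RintegralZl//; last exact: tilted_integrable.
by apply: eq_Rintegral => w _; rewrite d1f.
Unshelve. all: by end_near. Qed.

End TiltedMoments.

(** Extending [h] and [T] by zero outside [D] gives a jointly measurable nonnegative integrand on
    the plane, so Tonelli applies; the factor [h] kills it outside [D]. *)
Lemma measurable_partition_function {R : realType} (D : set R) (h T : R -> R) :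
  measurable D -> measurable_fun D h -> measurable_fun D T ->
  (forall y, D y -> 0 <= h y) ->
  measurable_fun [set: R] ((fun x =>
    \int[lebesgue_measure]_(y in D) (h y * expR (x * T y))%:E)%E : R -> \bar R).
Proof.
move=> mD mh mT h0.
have mh' : measurable_fun setT (h \_ D) by apply/measurable_restrict => //; rewrite setTI.
have mT' : measurable_fun setT (T \_ D) by apply/measurable_restrict => //; rewrite setTI.
pose F (z : R * R) := ((h \_ D) z.2 * expR (z.1 * (T \_ D) z.2))%:E.
have mF : measurable_fun setT F.
  apply/measurable_EFinP; apply: measurable_funM.
    exact: (measurableT_comp mh' measurable_snd).
  apply: measurableT_comp; first exact: measurable_expR.
  apply: measurable_funM; first exact: measurable_fst.
  exact: (measurableT_comp mT' measurable_snd).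
have F0 z : (0 <= F z)%E.
  rewrite lee_fin mulr_ge0 ?expR_ge0// patchE; case: ifPn => // /set_mem.
  exact: h0.
have := @measurable_fun_fubini_tonelli_F _ _ _ _ _ (@lebesgue_measure R) F mF F0.
congr (measurable_fun _ _); apply/funext => x.
rewrite /fubini_F [RHS]integral_mkcond; apply: eq_integral => y _.
rewrite /F /= !patchE; case: ifPn => // _.
by rewrite mul0r.
Qed.

(** * Integrals of a continuous derivative over oriented segments *)

Section FundamentalTheorem.
Context {R : realType}.
Variables (D : set R) (L W : R -> R).
Hypothesis L_derive : forall u, D u -> is_derive u 1 L (W u).
Hypothesis W_cont : forall u, D u -> {for u, continuous W}.

Let W_within a b : `[a, b]%classic `<=` D -> {within `[a, b], continuous W}.
Proof.
move=> abD; apply: continuous_in_subspaceT => u /set_mem/abD; exact: W_cont.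
Qed.

Let FTC a b : a < b -> `[a, b]%classic `<=` D ->
  \int[lebesgue_measure]_(u in `[a, b]) W u = L b - L a.
Proof.
move=> ab abD; rewrite /Rintegral (@continuous_FTC2 _ _ L)//.
- exact: W_within.
- have cL u : D u -> {for u, continuous L}.
    move=> /L_derive[dL _].
    by apply: differentiable_continuous; exact/derivable1_diffP.
  split.
  + by move=> u /subset_itv_oo_cc/abD/L_derive[].
  + by apply: cvg_at_right_filter; apply/cL/abD; rewrite /= in_itv/= lexx ltW.
  + by apply: cvg_at_left_filter; apply/cL/abD; rewrite /= in_itv/= lexx ltW.
- by move=> u /subset_itv_oo_cc/abD/L_derive[_ <-]; rewrite derive1E.
Qed.

Lemma integrable_segment a b : segment_between a b `<=` D ->
  lebesgue_measure.-integrable (segment_between a b) (EFin \o W).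
Proof.
move=> abD; apply: continuous_compact_integrable; first exact: segment_compact.
exact: W_within.
Qed.

Lemma oriented_integral_FTC a b : segment_between a b `<=` D ->
  oriented_integral W a b = L b - L a.
Proof.
rewrite /segment_between /oriented_integral.
case: (ltgtP a b) => [ab|ba|<-] abD.
- exact: FTC.
- by rewrite FTC// opprB.
- by rewrite set_itv1 Rintegral_set1 subrr.
Qed.

End FundamentalTheorem.

(** The identity is carried on a neighbourhood of [y], since each application of the operator
    differentiates the previous one. Continuity keeps T' nonzero nearby, so 1/T' cancels the T' in
    the derivative of [F k]. *)
Lemma Dop_near {R : realType} (T E : R -> R) (F : nat -> R -> R) (c y : R) :
  {for y, continuous (derive1 T)} -> derive1 T y != 0 ->
  (\forall u \near y, E u = c * F 0%N u) ->
  (forall k, \forall u \near y,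
     is_derive (u : R) (1 : R) (F k) (derive1 T u * F k.+1 u)) ->
  forall k, \forall u \near y, Dop T k E u = c * F k u.
Proof.
move=> cT Ty E0 dF; elim=> [|k IH]; first exact: E0.
(* The induction hypothesis holds near every point near [y], so it can be differentiated there. *)
have IH2 := near_join IH.
have Tn0 : \forall u \near y, derive1 T u != 0.
  exact: cvgr_neq0 cT Ty.
near=> u.
have Eu : \forall v \near u, c * F k v = Dop T k E v.
  have : \forall v \near u, Dop T k E v = c * F k v by near: u.
  by apply: filterS => v ->.
have dFu : is_derive u 1 (F k) (derive1 T u * F k.+1 u) by near: u; exact: dF.
have [_ eqD] : is_derive u 1 (Dop T k E) (c * (derive1 T u * F k.+1 u)).
  by apply: near_eq_is_derive Eu _; exact: is_deriveZ.
rewrite -derive1E in eqD; rewrite [LHS]/= -/(Dop T k E) eqD.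
by rewrite mulrCA mulKf//; near: u.
Unshelve. all: by end_near. Qed.

(** * Posterior moments of the exponential family *)

Section ExponentialFamily.
Context {R : realType} {d : measure_display} {Omega : measurableType d}.
Variables (P : probability Omega R) (X : {RV P >-> R}).
Variables (SX SY : set R) (T phi h : R -> R) (f : R -> R -> R).
Hypothesis hX : forall w, SX (X w).
Hypothesis SY_open : open SY.
Hypothesis h_meas : measurable_fun SY h.
Hypothesis h_ge0 : forall y, SY y -> 0 <= h y.
Hypothesis T_cont : forall y, SY y -> {for y, continuous T}.
Hypothesis f_mass : forall x, SX x ->
  (\int[lebesgue_measure]_(y in SY) (f x y)%:E = 1)%E.
Hypothesis f_expfam : forall x y, SX x -> SY y ->
  f x y = h y * expR (x * T y - phi x).
Hypothesis hreg : regularity X SX SY f.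

Let g w := expR (- phi (X w)).
Let F := tilted_moment P X g T.

Let fE w y : SY y -> f (X w) y = h y * (expR (X w * T y) * g w).
Proof. by move=> Dy; rewrite f_expfam// expRD. Qed.

(* Normalization recovers the measurability of [phi \o X], on which nothing is
   assumed: [expR (phi x)] is the integral of [h y * expR (x * T y)]. *)
Lemma measurable_log_partition : measurable_fun setT (phi \o X).
Proof.
have mSY : measurable SY by exact: open_measurable.
have mT : measurable_fun SY T.
  by apply: open_continuous_measurable_fun => // y /set_mem; exact: T_cont.
pose N : R -> \bar R := (fun x =>
  \int[lebesgue_measure]_(y in SY) (h y * expR (x * T y))%:E)%E.
have mN : measurable_fun setT N by exact: measurable_partition_function.
have NE w : N (X w) = (expR (phi (X w)))%:E.
  have fN : (\int[lebesgue_measure]_(y in SY) (f (X w) y)%:E =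
      \int[lebesgue_measure]_(y in SY)
        ((expR (- phi (X w)))%:E * (h y * expR (X w * T y))%:E))%E.
    apply: eq_integral => y /set_mem Dy.
    by rewrite fE// -EFinM /g mulrA mulrC.
  have := f_mass (hX w); rewrite fN.
  rewrite ge0_integralZl_EFin ?expR_ge0//; last 2 first.
  - by move=> y Dy; rewrite lee_fin mulr_ge0 ?expR_ge0// h_ge0.
  - apply/measurable_EFinP; apply: measurable_funM => //.
    apply: measurableT_comp; first exact: measurable_expR.
    exact: measurable_funM.
  move=> /(congr1 (fun z => (expR (phi (X w)))%:E * z)%E).
  by rewrite muleA -EFinM expRxMexpNx_1 mul1e mule1.
rewrite (_ : phi \o X = @ln R \o (fine \o (N \o X))); last first.
  by apply/funext => w /=; rewrite NE /= expRK.
apply: measurableT_comp; first exact: measurable_ln.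
apply: measurableT_comp; first exact: fine_measurable.
by apply: measurableT_comp => //; exact: measurable_funP.
Qed.

Lemma measurable_tilt k s :
  measurable_fun setT (fun w => X w ^+ k * expR (X w * s) * g w).
Proof.
have mX : measurable_fun setT X by exact: measurable_funP.
apply: measurable_funM.
  apply: measurable_funM; first exact: measurable_funX.
  apply: measurableT_comp; first exact: measurable_expR.
  by apply: measurable_funM.
apply: measurableT_comp; first exact: measurable_expR.
by apply: measurableT_comp => //; exact: measurable_log_partition.
Qed.

(** Total mass 1 excludes an empty sample space; a sample [w] supplies a point [X w] of [SX] at
    which to read the information density. *)
Let Omega_neq0 : exists w : Omega, True.
Proof.
apply: contrapT => /forallNP O0; have := @probability_setT _ _ _ P.
rewrite (_ : setT = set0) ?measure0; last first.
  by apply/seteqP; split => // w; have := O0 w.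
by move=> /esym/eqP; rewrite onee_eq0.
Qed.

(** All follows from finiteness of the information density at one [X w]: a zero density or an
    infinite marginal makes its logarithm -oo, a zero marginal makes it +oo. *)
Lemma base_marginal_pos y : SY y ->
  0 < h y /\ exists2 m : R, 0 < m & marginal_pdf X f y = m%:E.
Proof.
move=> Dy; have [w _] := Omega_neq0.
have [/(_ _ _ (hX w) Dy) fin _ _ _] := hreg.
have fw0 : f (X w) y != 0.
  by apply: contraTneq fin => f0; rewrite /info_density f0 mul0e /= lexx.
have h0 : 0 < h y.
  rewrite lt0r h_ge0// andbT; apply: contraNneq fw0 => h0.
  by rewrite fE// h0 mul0r.
split => //.
have f_gt0 : 0 < f (X w) y by rewrite fE// !mulr_gt0 ?expR_gt0.
have m0 : (0 <= marginal_pdf X f y)%E.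
  apply: integral_ge0 => v _.
  by rewrite lee_fin fE// !mulr_ge0 ?expR_ge0// ltW.
move: fin m0; rewrite /info_density.
case: (marginal_pdf X f y) => [m| |]//.
- move=> fin; rewrite lee_fin le_eqVlt => /predU1P[m0|m0]; last by exists m.
  by move: fin; rewrite -m0 inve0 gt0_muley ?lte_fin.
- by rewrite invey mule0 /= lexx.
Qed.

(** Conditional moment bounds pass to the tilted integrand on multiplying by the marginal density,
    positive and finite, and dividing by [h y], positive. *)
Lemma integrable_tilt k y : SY y ->
  P.-integrable setT (EFin \o (fun w => X w ^+ k * expR (X w * T y) * g w)).
Proof.
move=> Dy; have [h0 [m m0 mE]] := base_marginal_pos Dy.
have mf : measurable_fun setT (fun w => X w ^+ k * f (X w) y).
  rewrite (_ : (fun w => _) =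
      (fun w => h y * (X w ^+ k * expR (X w * T y) * g w))).
    by apply: measurable_funM => //; exact: measurable_tilt.
  by apply/funext => w; rewrite fE//; ring.
have int_f : P.-integrable setT (EFin \o (fun w => X w ^+ k * f (X w) y)).
  apply/integrableP; split; first exact/measurable_EFinP.
  rewrite (@eq_integral _ _ _ _ _ (fun w => (`|X w ^+ k| * f (X w) y)%:E)); last first.
    move=> w _; rewrite /= normrM [`|f _ _|]ger0_norm// fE//.
    by rewrite !mulr_ge0 ?expR_ge0// ltW.
  (* The moment conditions start at order 1; at order 0 the integral is the marginal density, known
     to be finite. *)
  case: k {mf} => [|k].
    rewrite (@eq_integral _ _ _ _ _ (fun w => (f (X w) y)%:E)).
      by rewrite [ltLHS]mE ltry.
    by move=> w _; rewrite expr0 normr1 mul1r.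
  have [_ /(_ k.+1 isT _ Dy)[fin _ _] _ _] := hreg.
  move: fin; rewrite /cond_expectation mE inver gt_eqF//.
  by rewrite lte_pdivrMr// gt0_mulye ?lte_fin.
rewrite (_ : EFin \o _ = fun w =>
    ((h y)^-1%:E * (EFin \o (fun w => (X w ^+ k * f (X w) y)%R)) w)%E).
  exact: integrableZl.
apply/funext => w; rewrite /= -EFinM fE//; congr EFin.
by field; rewrite gt_eqF.
Qed.

Lemma tilted_moment0_gt0 y : SY y -> 0 < F 0%N y.
Proof.
move=> Dy; have [h0 [m m0 mE]] := base_marginal_pos Dy.
have : (h y * F 0%N y)%:E = m%:E.
  rewrite -mE EFinM /F /tilted_moment /Rintegral fineK; last first.
    by apply: integrable_fin_num => //; exact: integrable_tilt.
  rewrite -integralZl//; last exact: integrable_tilt.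
  by apply: eq_integral => w _; rewrite -EFinM expr0 mul1r fE.
by move=> [hF]; rewrite -(pmulr_rgt0 _ h0) hF.
Qed.

Lemma cond_expectation_tilted k y : SY y ->
  cond_expectation X f (fun x => x ^+ k) y = (F k y / F 0%N y)%:E.
Proof.
move=> Dy; have [h0 _] := base_marginal_pos Dy.
have hF j : (\int[P]_w (X w ^+ j * f (X w) y)%:E = (h y * F j y)%:E)%E.
  rewrite EFinM /F /tilted_moment /Rintegral fineK; last first.
    by apply: integrable_fin_num => //; exact: integrable_tilt.
  rewrite -integralZl//; last exact: integrable_tilt.
  by apply: eq_integral => w _; rewrite -EFinM fE//; congr EFin; ring.
rewrite /cond_expectation hF.
have -> : marginal_pdf X f y = (h y * F 0%N y)%:E.
  by rewrite -hF; apply: eq_integral => w _; rewrite expr0 mul1r.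
have F0 := tilted_moment0_gt0 Dy.
rewrite inver gt_eqF ?mulr_gt0// -EFinM; congr EFin.
by field; rewrite !gt_eqF.
Qed.

End ExponentialFamily.

(** * The moment identity from the iterated operator *)

Theorem theorem3 (R : realType) (d : measure_display) (Omega : measurableType d)
    (P : probability Omega R) (X Y : {RV P >-> R}) (SX SY : set R)
    (T phi h : R -> R) (f : R -> R -> R)
    (hX : forall w, SX (X w)) (hY : forall w, SY (Y w))
    (SY_open : open SY)
    (h_meas : measurable_fun SY h) (h_ge0 : forall y, SY y -> 0 <= h y)
    (T_analytic : forall y, SY y -> real_analytic_at T y)
    (T_isolated : forall y, SY y -> derive1 T y = 0 ->
       \forall u \near y^', derive1 T u != 0)
    (f_pdf : is_conditional_pdf X Y SX SY f)
    (f_expfam : forall x y, SX x -> SY y ->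
       f x y = h y * expR (x * T y - phi x))
    (hreg : regularity X SX SY f)
    (l : nat) (a y : R) (ha : SY a) (hy : SY y)
    (hay : segment_between a y `<=` SY) (hT : derive1 T y != 0) :
  let E := fun v => expR (oriented_integral (weighted_mean X f T) a v) in
  [/\ (lebesgue_measure.-integrable (segment_between a y)
         (EFin \o weighted_mean X f T)),
      (forall k : nat, (k <= l)%N -> derivable (Dop T k E) y 1) &
      cond_expectation X f (fun x => x ^+ l.+1) y =
      (expR (- oriented_integral (weighted_mean X f T) a y)
       * Dop T l.+1 E y)%:E].
Proof.
move=> E.
have TD u : SY u -> derivable T u 1.
  by move=> /T_analytic/real_analytic_derivable[].
have TC1 u : SY u -> {for u, continuous (derive1 T)}.
  by move=> /T_analytic/real_analytic_derivable[].
have TC u : SY u -> {for u, continuous T}.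
  by move=> /TD dT; apply: differentiable_continuous; exact/derivable1_diffP.
have f_mass x : SX x -> (\int[lebesgue_measure]_(u in SY) (f x u)%:E = 1)%E.
  by move=> /(f_pdf.1 x)[].
pose F := tilted_moment P X (fun w => expR (- phi (X w))) T.
have F_derive k u : SY u -> is_derive u 1 (F k) (derive1 T u * F k.+1 u).
  apply: is_derive_tilted_moment => // i v Dv.
  exact: (integrable_tilt hX SY_open h_meas h_ge0 TC f_mass f_expfam hreg).
have F0_gt0 u : SY u -> 0 < F 0%N u.
  exact: (tilted_moment0_gt0 hX SY_open h_meas h_ge0 TC f_mass f_expfam hreg).
have condE k u : SY u ->
    cond_expectation X f (fun x => x ^+ k) u = (F k u / F 0%N u)%:E.
  exact: (cond_expectation_tilted hX SY_open h_meas h_ge0 TC f_mass f_expfam hreg).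
have F_cont k u : SY u -> {for u, continuous (F k)}.
  move=> /(F_derive k)[dF _].
  by apply: differentiable_continuous; exact/derivable1_diffP.
have WE u : SY u -> weighted_mean X f T u = derive1 T u * (F 1%N u / F 0%N u).
  move=> Du; rewrite /weighted_mean; congr (_ * _).
  by have /(congr1 fine) := condE 1%N u Du.
have SY_nbhs u : SY u -> \forall v \near u, SY v.
  by move=> Du; exact: open_nbhs_nbhs.
have W_cont u : SY u -> {for u, continuous (weighted_mean X f T)}.
  move=> Du; rewrite /prop_for /continuous_at WE//.
  have : derive1 T v * (F 1%N v / F 0%N v) @[v --> u] -->
      derive1 T u * (F 1%N u / F 0%N u).
    apply: cvgM; first exact: TC1.
    apply: cvgM; first exact: F_cont.
    by apply: cvgV; [rewrite gt_eqF ?F0_gt0|exact: F_cont].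
  apply: cvg_trans; apply: near_eq_cvg.
  by apply: filterS (SY_nbhs _ Du) => v Dv; rewrite WE.
have L_derive u : SY u ->
    is_derive u 1 (fun v => ln (F 0%N v)) (weighted_mean X f T u).
  move=> Du; have dF := F_derive 0%N _ Du.
  have dln := is_derive1_ln (F0_gt0 _ Du).
  have := is_derive1_comp dln dF.
  by rewrite WE// => D; apply: is_derive_eq D _; ring.
have EE v : segment_between a v `<=` SY -> SY v -> E v = (F 0%N a)^-1 * F 0%N v.
  move=> av Dv; rewrite /E (oriented_integral_FTC L_derive W_cont)//.
  by rewrite expRB !lnK ?posrE ?F0_gt0// mulrC.
(* [Dop] differentiates [E] near [y], so the segment from [a] to a nearby [v] must stay in [SY]: its
   points outside the segment from [a] to [y] lie between [y] and [v], hence in a ball around [y]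
   inside [SY]. *)
have near_seg : \forall v \near y, segment_between a v `<=` SY.
  have /nbhs_ballP[e /= e0 eSY] := SY_nbhs _ hy.
  apply/nbhs_ballP; exists e => //= v yv u.
  rewrite /segment_between /= in_itv/= ge_min le_max => uav.
  have [uay|nuay] := boolP (u \in `[Order.min a y, Order.max a y]).
    exact: hay.
  apply: eSY; move: yv uav nuay; rewrite /ball/= in_itv/= ge_min le_max.
  rewrite !ltr_norml => /andP[? ?] /andP[/orP[?|?] /orP[?|?]];
    rewrite negb_and !negb_or -!ltNge => /orP[/andP[? ?]|/andP[? ?]];
    by apply/andP; split; lra.
have E_near : \forall u \near y, E u = (F 0%N a)^-1 * F 0%N u.
  by near=> u; apply: EE; near: u => //; exact: SY_nbhs.
have DopE k : \forall u \near y, Dop T k E u = (F 0%N a)^-1 * F k u.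
  apply: Dop_near => //; first exact: TC1.
  by move=> i; apply: filterS (SY_nbhs _ hy); exact: F_derive.
(* Integrability and derivability show that the integral up to [y] and the derivatives taken at [y]
   are not default values. *)
split.
- exact: (integrable_segment W_cont).
- move=> k _; apply: (near_eq_derivable (f := fun u => (F 0%N a)^-1 * F k u)).
    by apply: filterS (DopE k) => u ->.
  have [dF _] := F_derive k _ hy.
  exact: derivableZ.
- rewrite condE// (nbhs_singleton (DopE l.+1)).
  (* The prefactor is 1/E(y) = F_0(a)/F_0(y), so F_0(a) cancels. *)
  rewrite expRN -/(E y) EE//; congr EFin.
  by field; rewrite !gt_eqF ?F0_gt0.
Unshelve. all: by end_near. Qed.
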